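(* Let $d\ge 2$, $\varepsilon>0$, $N\in\mathbb{N}$, and let $w_1,\dots,w_N>0$ be constant weights. Let $v_1(t),\dots,v_N(t)\in\mathbb{R}^d$ be a solution of the deterministic particle system $$\frac{\mathrm{d} v_i(t)}{\mathrm{d}t} = - \sum_{j=1}^N w_j\, A(v_i-v_j)\, b^N_\varepsilon(v_i,v_j),\qquad i=1,\dots,N,$$ where $b^N_\varepsilon(v_i,v_j)=g^N_\varepsilon(v_i)-g^N_\varepsilon(v_j)$ and $g^N_\varepsilon$ is the gradient of the variation of the anti-symmetric regularised entropy, $$g^N_\varepsilon(v_i) = \frac{\nabla\tilde{f}^N(v_i,t)}{\tilde{f}^N(v_i,t)} + \sum_{k=1}^N w_k \frac{\nabla\psi_\varepsilon(v_i-v_k)}{\tilde{f}^N(v_k,t)}.$$ Then the following hold. 1. Conservation of mass, momentum and energy: $$\frac{\mathrm{d}}{\mathrm{d}t} \sum_{i=1}^{N} w_i = 0,\qquad \frac{\mathrm{d}}{\mathrm{d}t} \sum_{i=1}^{N} w_i v_i(t) = 0,\qquad \frac{\mathrm{d}}{\mathrm{d}t} \sum_{i=1}^{N} w_i |v_i(t)|^2= 0.$$ 2. Dissipation of the discrete entropy: $$\frac{\mathrm{d}}{\mathrm{d}t} \mathcal{H}^N_\varepsilon = - \mathcal{D}^N_\varepsilon \leq 0,$$ where $$\mathcal{H}^N_\varepsilon = \sum_{i=1}^N w_i \log\left( \sum_{j=1}^N w_j \psi_\varepsilon(v_i-v_j) \right),\qquad \mathcal{D}^N_\varepsilon = \frac{1}{2}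 \sum_{i,j=1}^N w_i w_j\, b^N_\varepsilon(v_i,v_j) \cdot A(v_i-v_j)\, b^N_\varepsilon(v_i,v_j).$$
   Context: The matrix $A$ is the Landau collision kernel $A(q) = C |q|^{\gamma+2} S(q)$, $S(q) = I - \frac{q \otimes q}{|q|^2}$, for $q\in\mathbb{R}^d\setminus\{0\}$, with $C>0$, $-d-1\le\gamma\le 1$, and $I$ the $d\times d$ identity matrix; it is symmetric and positive semi-definite. Convention: $A(0)=0$ (the value is immaterial in the scheme, since $b^N_\varepsilon(v_i,v_j)=0$ when $v_i=v_j$). The Gaussian mollifier of variance $\varepsilon$ is $\psi_\varepsilon (v) = \frac{1}{(2\pi\varepsilon)^{d/2}}\exp\left(-\frac{|v|^2}{2\varepsilon}\right)$, $v\in\mathbb{R}^d$. The smoothed (blob) solution is $\tilde{f}^N(v,t) = \sum_{i=1}^{N} w_i \psi_\varepsilon(v-v_i(t))$, and $\nabla\tilde f^N$ denotes its gradient in $v$. The time dependence of $v_i$ is omitted where convenient. *)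

(* Defs.v *)
From HB Require Import structures.
From mathcomp Require Import all_boot all_order all_algebra.
From mathcomp Require Import all_classical all_reals all_analysis.
Import Order.TTheory GRing.Theory Num.Theory.
Import numFieldNormedType.Exports.

Set Implicit Arguments.
Unset Strict Implicit.
Unset Printing Implicit Defensive.

Local Open Scope classical_set_scope.
Local Open Scope ring_scope.

(* R^d is the type 'cV[R]_d of column vectors.  The norm `|x| of the library on
   this type is the sup norm, so the Euclidean structure is defined here; the
   sup norm is only used for the topology, hence for derivatives. *)

Definition dotp {R : realType} {d : nat} (x y : 'cV[R]_d) : R :=
  \sum_(k < d) x k ord0 * y k ord0.

Definition enorm {R : realType} {d : nat} (x : 'cV[R]_d) : R :=
  Num.sqrt (dotp x x).

Definition gradient {R : realType} {d : nat} (f : 'cV[R]_d -> R)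
    (x : 'cV[R]_d) : 'cV[R]_d :=
  \col_(k < d) 'D_(delta_mx k ord0) f x.

(* The exponent gamma + 2 is real and may be negative. *)
Definition landau_kernel {R : realType} {d : nat} (C gamma : R)
    (q : 'cV[R]_d) : 'M[R]_d :=
  if q == 0 then 0
  else (C * enorm q `^ (gamma + 2)) *:
         (1%:M - (enorm q ^+ 2)^-1 *: (q *m q^T)).

Definition mollifier {R : realType} {d : nat} (eps : R) (v : 'cV[R]_d) : R :=
  ((2 * pi * eps) `^ (d%:R / 2))^-1 * expR (- (enorm v ^+ 2 / (2 * eps))).

(* In the following, x : 'I_N -> 'cV[R]_d is the family of the positions of the
   particles at a given time. *)

Definition blob {R : realType} {d N : nat} (eps : R) (w : 'I_N -> R)
    (x : 'I_N -> 'cV[R]_d) (v : 'cV[R]_d) : R :=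
  \sum_(i < N) w i * mollifier eps (v - x i).

Definition entropy_gradient {R : realType} {d N : nat} (eps : R)
    (w : 'I_N -> R) (x : 'I_N -> 'cV[R]_d) (v : 'cV[R]_d) : 'cV[R]_d :=
  (blob eps w x v)^-1 *: gradient (blob eps w x) v
  + \sum_(k < N)
      (w k / blob eps w x (x k)) *: gradient (mollifier eps) (v - x k).

Definition entropy_gradient_diff {R : realType} {d N : nat} (eps : R)
    (w : 'I_N -> R) (x : 'I_N -> 'cV[R]_d) (u v : 'cV[R]_d) : 'cV[R]_d :=
  entropy_gradient eps w x u - entropy_gradient eps w x v.

Definition particle_solution {R : realType} {d N : nat} (C gamma eps : R)
    (w : 'I_N -> R) (J : set R) (v : 'I_N -> R -> 'cV[R]_d) : Prop :=
  forall (t : R) (i : 'I_N), J t ->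
    is_derive t 1 (v i)
      (- \sum_(j < N) w j *:
           (landau_kernel C gamma (v i t - v j t)
              *m entropy_gradient_diff eps w (v^~ t) (v i t) (v j t))).

Definition discrete_entropy {R : realType} {d N : nat} (eps : R)
    (w : 'I_N -> R) (x : 'I_N -> 'cV[R]_d) : R :=
  \sum_(i < N) w i * ln (\sum_(j < N) w j * mollifier eps (x i - x j)).

Definition entropy_dissipation {R : realType} {d N : nat} (C gamma eps : R)
    (w : 'I_N -> R) (x : 'I_N -> 'cV[R]_d) : R :=
  2^-1 * \sum_(i < N) \sum_(j < N) w i * w j *
    dotp (entropy_gradient_diff eps w x (x i) (x j))
         (landau_kernel C gamma (x i - x j)
            *m entropy_gradient_diff eps w x (x i) (x j)).

(* Main.v *)
Require Import Defs.
From HB Require Import structures.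
From mathcomp Require Import all_boot all_order all_algebra.
From mathcomp Require Import all_classical all_reals all_analysis.
From mathcomp Require Import ring.
Import Order.TTheory GRing.Theory Num.Theory.
Import numFieldNormedType.Exports.

Local Open Scope classical_set_scope.
Local Open Scope ring_scope.

(** Everything follows from one identity.  Write [F i j = A(v_i - v_j) b(v_i, v_j)]
    for the interaction force.  Since [A] is even and [b] is antisymmetric,
    [F j i = - F i j], and exchanging the two particles in the double sum gives
    the weak form ([weak_form]): for all test vectors [phi_i],

      [sum_i w_i phi_i . v_i'
         = - 1/2 sum_(i,j) w_i w_j (phi_i - phi_j) . F i j].

    Each law is this identity for one choice of [phi].
    - Momentum: [phi_i] is a fixed basis vector, so [phi_i - phi_j = 0].
    - Energy: [phi_i = v_i]; the right-hand side vanishes because [A q y] is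
      orthogonal to [q] ([dotp_landau_kernel_self]).
    - Entropy: [phi_i = g(v_i)]; the right-hand side is [- D], and it is
      nonpositive because [A] is positive semi-definite ([landau_kernel_psd]).

    The entropy case also needs the chain rule
    [dH/dt = sum_i w_i g(v_i) . v_i'] along arbitrary differentiable
    trajectories ([is_derive_discrete_entropy]): it says that [g] is indeed the
    gradient of the variation of the entropy.  The second sum in [g] comes from
    the dependence of the blob on the positions of all the particles, and the
    oddness of the gradient of the mollifier gives it its sign.

    The mollifier is differentiated along curves; its directional derivatives,
    hence its gradient and that of the blob, are the case of straight lines
    ([is_derive_line]). *)

(** * The Euclidean inner product *)

Lemma dotpC {R : realType} {d : nat} (x y : 'cV[R]_d) : dotp x y = dotp y x.
Proof. by apply: eq_bigr => k _; rewrite mulrC. Qed.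

Lemma dotpDr {R : realType} {d : nat} (x y z : 'cV[R]_d) :
  dotp x (y + z) = dotp x y + dotp x z.
Proof. by rewrite -big_split; apply: eq_bigr => k _; rewrite mxE mulrDr. Qed.

Lemma dotpZr {R : realType} {d : nat} (a : R) (x y : 'cV[R]_d) :
  dotp x (a *: y) = a * dotp x y.
Proof.
by rewrite /dotp mulr_sumr; apply: eq_bigr => k _; rewrite mxE mulrCA.
Qed.

Lemma dotpNr {R : realType} {d : nat} (x y : 'cV[R]_d) :
  dotp x (- y) = - dotp x y.
Proof. by rewrite -scaleN1r dotpZr mulN1r. Qed.

Lemma dotpBr {R : realType} {d : nat} (x y z : 'cV[R]_d) :
  dotp x (y - z) = dotp x y - dotp x z.
Proof. by rewrite dotpDr dotpNr. Qed.

Lemma dotp_sumr {R : realType} {d n : nat} (x : 'cV[R]_d)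
    (F : 'I_n -> 'cV[R]_d) :
  dotp x (\sum_(i < n) F i) = \sum_(i < n) dotp x (F i).
Proof.
rewrite /dotp exchange_big; apply: eq_bigr => k _.
by rewrite summxE mulr_sumr.
Qed.

Lemma dotpDl {R : realType} {d : nat} (x y z : 'cV[R]_d) :
  dotp (x + y) z = dotp x z + dotp y z.
Proof. by rewrite dotpC dotpDr !(dotpC z). Qed.

Lemma dotpZl {R : realType} {d : nat} (a : R) (x y : 'cV[R]_d) :
  dotp (a *: x) y = a * dotp x y.
Proof. by rewrite dotpC dotpZr dotpC. Qed.

Lemma dotpNl {R : realType} {d : nat} (x y : 'cV[R]_d) :
  dotp (- x) y = - dotp x y.
Proof. by rewrite dotpC dotpNr dotpC. Qed.

Lemma dotpBl {R : realType} {d : nat} (x y z : 'cV[R]_d) :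
  dotp (x - y) z = dotp x z - dotp y z.
Proof. by rewrite dotpDl dotpNl. Qed.

Lemma dotp_suml {R : realType} {d n : nat} (x : 'cV[R]_d)
    (F : 'I_n -> 'cV[R]_d) :
  dotp (\sum_(i < n) F i) x = \sum_(i < n) dotp (F i) x.
Proof. by rewrite dotpC dotp_sumr; apply: eq_bigr => i _; rewrite dotpC. Qed.

Lemma dotp0r {R : realType} {d : nat} (x : 'cV[R]_d) : dotp x 0 = 0.
Proof. by rewrite /dotp big1 // => k _; rewrite mxE mulr0. Qed.

Lemma dotp_deltar {R : realType} {d : nat} (x : 'cV[R]_d) (k : 'I_d) :
  dotp x (delta_mx k ord0) = x k ord0.
Proof.
rewrite /dotp (bigD1 k) //= mxE !eqxx mulr1 big1 ?addr0 // => j jk.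
by rewrite mxE (negPf jk) mulr0.
Qed.

Lemma dotp_ge0 {R : realType} {d : nat} (x : 'cV[R]_d) : 0 <= dotp x x.
Proof. by apply: sumr_ge0 => k _; rewrite -expr2 sqr_ge0. Qed.

Lemma dotp_eq0 {R : realType} {d : nat} (x : 'cV[R]_d) :
  (dotp x x == 0) = (x == 0).
Proof.
apply/idP/eqP => [|->]; last by rewrite dotp0r.
rewrite psumr_eq0 => [/allP x0|k _]; last by rewrite -expr2 sqr_ge0.
apply/matrixP => k j; rewrite ord1 mxE; apply/eqP.
by have := x0 k (mem_index_enum _); rewrite /= mulf_eq0 orbb.
Qed.

Lemma enorm_sqr {R : realType} {d : nat} (x : 'cV[R]_d) :
  enorm x ^+ 2 = dotp x x.
Proof. by rewrite sqr_sqrtr // dotp_ge0. Qed.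

(** * The Landau kernel *)

Lemma dotp_landau_kernel {R : realType} {d : nat} (C gamma : R)
    (q x y : 'cV[R]_d) : q != 0 ->
  dotp x (landau_kernel C gamma q *m y) =
  (C * enorm q `^ (gamma + 2)) *
    (dotp x y - (dotp q q)^-1 * (dotp x q * dotp q y)).
Proof.
move=> q0; rewrite /landau_kernel (negPf q0) enorm_sqr -scalemxAl dotpZr.
congr (_ * _); rewrite mulmxBl mul1mx -scalemxAl dotpBr dotpZr -mulmxA.
have -> : q^T *m y = (dotp q y)%:M.
  apply/matrixP => i j; rewrite !ord1 !mxE mulr1n.
  by apply: eq_bigr => k _; rewrite mxE.
by rewrite mul_mx_scalar dotpZr (mulrC (dotp q y)).
Qed.

Lemma landau_kernelN {R : realType} {d : nat} (C gamma : R) (q : 'cV[R]_d) :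
  landau_kernel C gamma (- q) = landau_kernel C gamma q.
Proof.
rewrite /landau_kernel /enorm oppr_eq0 dotpNl dotpNr opprK.
by rewrite [(- q)^T]raddfN mulNmx mulmxN opprK.
Qed.

Lemma dotp_landau_kernel_self {R : realType} {d : nat} (C gamma : R)
    (q y : 'cV[R]_d) : dotp q (landau_kernel C gamma q *m y) = 0.
Proof.
have [->|q0] := eqVneq q 0; first by rewrite dotpC dotp0r.
by rewrite dotp_landau_kernel // mulKf ?dotp_eq0// subrr mulr0.
Qed.

(** Up to a nonnegative factor, [x . A(q) x] is the squared length of the
    component of [x] orthogonal to [q]. *)
Lemma landau_kernel_psd {R : realType} {d : nat} (C gamma : R)
    (q x : 'cV[R]_d) : 0 <= C -> 0 <= dotp x (landau_kernel C gamma q *m x).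
Proof.
move=> C0; have [->|q0] := eqVneq q 0.
  by rewrite /landau_kernel eqxx mul0mx dotp0r.
rewrite dotp_landau_kernel // mulr_ge0 ?mulr_ge0 ?powR_ge0 //.
have qq : dotp q q != 0 by rewrite dotp_eq0.
(* The vector is [x] minus its orthogonal projection on [q]. *)
have := dotp_ge0 (x - ((dotp q q)^-1 * dotp x q) *: q).
rewrite dotpBl !dotpBr !dotpZl !dotpZr (dotpC q x).
by congr (0 <= _); field.
Qed.

(** * The weak form of the particle system *)

(** Exchanging [i] and [j] in the double sum replaces [phi i] by [- phi j];
    the right-hand side is the average of the two expressions. *)
Lemma weak_form {R : realType} {d N : nat} (w : 'I_N -> R)
    (F : 'I_N -> 'I_N -> 'cV[R]_d) (phi : 'I_N -> 'cV[R]_d) :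
    (forall i j, F j i = - F i j) ->
  \sum_(i < N) w i * dotp (phi i) (- \sum_(j < N) w j *: F i j) =
  - (2^-1 * \sum_(i < N) \sum_(j < N)
       w i * w j * dotp (phi i - phi j) (F i j)).
Proof.
move=> Fanti.
pose S := \sum_(i < N) \sum_(j < N) w i * w j * dotp (phi i) (F i j).
have -> : \sum_(i < N) w i * dotp (phi i) (- \sum_(j < N) w j *: F i j) = - S.
  rewrite -sumrN; apply: eq_bigr => i _.
  rewrite dotpNr dotp_sumr mulrN mulr_sumr; congr (- _).
  by apply: eq_bigr => j _; rewrite dotpZr mulrA.
have SE : \sum_(i < N) \sum_(j < N) w i * w j * dotp (phi j) (F i j) = - S.
  rewrite exchange_big -sumrN; apply: eq_bigr => i _.
  rewrite -sumrN; apply: eq_bigr => j _.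
  by rewrite Fanti dotpNr mulrN (mulrC (w i)).
suff -> : \sum_(i < N) \sum_(j < N) w i * w j * dotp (phi i - phi j) (F i j)
    = S - - S by field.
rewrite -SE -sumrB; apply: eq_bigr => i _.
by rewrite -sumrB; apply: eq_bigr => j _; rewrite dotpBl mulrBr.
Qed.

(** * Derivatives along curves *)

Lemma is_derive_sum_fun {R : realType} {V W : normedModType R} {n : nat}
    (h : 'I_n -> V -> W) (x v : V) (dh : 'I_n -> W) :
    (forall i, is_derive x v (h i) (dh i)) ->
  is_derive x v (fun y => \sum_(i < n) h i y) (\sum_(i < n) dh i).
Proof.
move=> hd; rewrite (_ : (fun y => _) = \sum_(i < n) h i); last first.
  by apply/funext => y; rewrite fct_sumE.
exact: is_derive_sum.
Qed.

(** Reduces directional derivatives in [V] to the calculus of functions of one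
    real variable, where the chain rule for [expR] is stated. *)
Lemma is_derive_line {R : realType} {V W : normedModType R} (f : V -> W)
    (a u : V) (df : W) :
  is_derive a u f df <-> is_derive (0 : R) (1 : R) (fun h => f (h *: u + a)) df.
Proof.
have E : (fun h : R => h^-1 *: ((f \o shift a) (h *: u) - f a)) =
   (fun h : R => h^-1 *: (((fun h => f (h *: u + a)) \o shift (0 : R)) (h *: 1)
      - f ((0 : R) *: u + a))).
  by apply/funext => h /=; rewrite addr0 scale0r add0r [h *: 1]mulr1.
by split=> -[D1 D2]; apply: DeriveDef; move: D1 D2;
  rewrite /derivable /derive E.
Qed.

Lemma is_derive_coord {R : realType} {m n : nat} (x : R -> 'M[R]_(m, n))
    (t : R) (x' : 'M[R]_(m, n)) (i : 'I_m) (j : 'I_n) :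
  is_derive t 1 x x' -> is_derive t 1 (fun s => x s i j) (x' i j).
Proof.
case=> D <-; apply: DeriveDef; first exact: (derivable_mxP _ _ _).1.
by rewrite derive_mx // mxE.
Qed.

Lemma is_derive_dotp {R : realType} {d : nat} (x y : R -> 'cV[R]_d) (t : R)
    (x' y' : 'cV[R]_d) : is_derive t 1 x x' -> is_derive t 1 y y' ->
  is_derive t 1 (fun s => dotp (x s) (y s)) (dotp x' (y t) + dotp (x t) y').
Proof.
move=> dx dy; rewrite /dotp -big_split /=.
apply: is_derive_sum_fun => k.
have dxk := is_derive_coord _ _ _ k ord0 dx.
have dyk := is_derive_coord _ _ _ k ord0 dy.
rewrite addrC (mulrC (x' k ord0)).
exact: (is_deriveM dxk dyk).
Qed.

(** * The mollifier and the blob *)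

Lemma mollifier_gt0 {R : realType} {d : nat} (eps : R) (q : 'cV[R]_d) :
  0 < eps -> 0 < mollifier eps q.
Proof.
move=> e0; rewrite mulr_gt0 ?expR_gt0 ?invr_gt0 ?powR_gt0 //.
by rewrite !mulr_gt0 ?pi_gt0.
Qed.

Lemma is_derive_mollifier_curve {R : realType} {d : nat} (eps : R)
    (x : R -> 'cV[R]_d) (t : R) (x' : 'cV[R]_d) :
  is_derive t 1 x x' ->
  is_derive t 1 (fun s => mollifier eps (x s))
    (dotp (- (mollifier eps (x t) / eps) *: x t) x').
Proof.
move=> dx.
have dE : is_derive t 1 (fun s => - (2 * eps)^-1 * dotp (x s) (x s))
    (- (2 * eps)^-1 * (dotp x' (x t) + dotp (x t) x')).
  exact: (is_deriveZ _ (is_derive_dotp _ _ _ _ _ dx dx)).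
set c := ((2 * pi * eps) `^ (d%:R / 2))^-1.
have mE (q : 'cV[R]_d) :
    mollifier eps q = c * expR (- (2 * eps)^-1 * dotp q q).
  by rewrite /mollifier enorm_sqr (mulrC (dotp q q)) mulNr.
rewrite (_ : (fun s => mollifier eps (x s)) =
   (fun s => c * expR (- (2 * eps)^-1 * dotp (x s) (x s)))); last first.
  by apply/funext => s; rewrite mE.
have dM : is_derive t 1
    (fun s => c * expR (- (2 * eps)^-1 * dotp (x s) (x s)))
    (c * (expR (- (2 * eps)^-1 * dotp (x t) (x t)) *
       (- (2 * eps)^-1 * (dotp x' (x t) + dotp (x t) x')))).
  exact: (is_deriveZ c (is_derive1_comp (is_derive_expR _) dE)).
apply: is_derive_eq; rewrite mE dotpZl (dotpC x') invfM.
(* The identity is polynomial in the inverse of [eps], so [eps] may be 0. *)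
by move: eps^-1 => u; field.
Qed.

Lemma gradientP {R : realType} {d : nat} (f : 'cV[R]_d -> R) (a g : 'cV[R]_d) :
    (forall u, is_derive a u f (dotp g u)) -> gradient f a = g.
Proof.
move=> dg; apply/matrixP => k j; rewrite ord1 mxE.
by have [_ ->] := dg (delta_mx k ord0); rewrite dotp_deltar.
Qed.

Lemma is_derive_translate {R : realType} {V W : normedModType R} (f : V -> W)
    (a c u : V) (df : W) :
  is_derive (a - c) u f df -> is_derive a u (fun v => f (v - c)) df.
Proof.
move=> /is_derive_line fd; apply/is_derive_line.
by under eq_fun do rewrite -addrA.
Qed.

Lemma is_derive_mollifier {R : realType} {d : nat} (eps : R)
    (q u : 'cV[R]_d) :
  is_derive q u (mollifier eps) (dotp (- (mollifier eps q / eps) *: q) u).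
Proof.
apply/is_derive_line.
have dx : is_derive (0 : R) 1 (fun h : R => h *: u + q) u.
  by have /is_derive_line := is_derive_id q u.
have := is_derive_mollifier_curve eps _ _ _ dx.
by rewrite scale0r add0r.
Qed.

Lemma gradient_mollifier {R : realType} {d : nat} (eps : R) (q : 'cV[R]_d) :
  gradient (mollifier eps) q = - (mollifier eps q / eps) *: q.
Proof. by apply: gradientP => u; apply: is_derive_mollifier. Qed.

Lemma gradient_mollifierN {R : realType} {d : nat} (eps : R) (q : 'cV[R]_d) :
  gradient (mollifier eps) (- q) = - gradient (mollifier eps) q.
Proof.
have moll_even : mollifier eps (- q) = mollifier eps q.
  by rewrite /mollifier !enorm_sqr dotpNl dotpNr opprK.
by rewrite !gradient_mollifier moll_even scalerN.
Qed.

Lemma gradient_blob {R : realType} {d N : nat} (eps : R) (w : 'I_N -> R)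
    (x : 'I_N -> 'cV[R]_d) (a : 'cV[R]_d) :
  gradient (blob eps w x) a =
  \sum_(i < N) w i *: gradient (mollifier eps) (a - x i).
Proof.
apply: gradientP => u; rewrite dotp_suml; apply: is_derive_sum_fun => i.
rewrite dotpZl gradient_mollifier; apply: is_deriveZ.
exact/is_derive_translate/is_derive_mollifier.
Qed.

(** The index [i] ensures that there is at least one particle: the blob of the
    empty family is zero. *)
Lemma blob_gt0 {R : realType} {d N : nat} (eps : R) (w : 'I_N -> R)
    (x : 'I_N -> 'cV[R]_d) (i : 'I_N) (a : 'cV[R]_d) :
  0 < eps -> (forall i, 0 < w i) -> 0 < blob eps w x a.
Proof.
move=> e0 w0; rewrite /blob (bigD1 i) //= ltr_wpDr //.
  by rewrite sumr_ge0 // => j _; rewrite ltW // mulr_gt0 // mollifier_gt0.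
by rewrite mulr_gt0 // mollifier_gt0.
Qed.

(** * The entropy and its dissipation *)

(** With [G i j] the gradient of the mollifier at [x_i - x_j] and [F i] the blob
    at [x_i], direct differentiation gives the sum over [i, j] of
    [w_i w_j / F_i * G i j . (x_i' - x_j')].  The terms with [x_j'] are
    reindexed by exchanging [i] and [j]; as [G j i = - G i j], they become
    [w_i w_j / F_j * G i j . x_i'], which is the second sum in the entropy
    gradient. *)
Lemma is_derive_discrete_entropy {R : realType} {d N : nat} (eps : R)
    (w : 'I_N -> R) (x : 'I_N -> R -> 'cV[R]_d) (t : R)
    (x' : 'I_N -> 'cV[R]_d) :
    0 < eps -> (forall i, 0 < w i) ->
    (forall i, is_derive t 1 (x i) (x' i)) ->
  is_derive t 1 (fun s => discrete_entropy eps w (x^~ s))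
    (\sum_(i < N) w i * dotp (entropy_gradient eps w (x^~ t) (x i t)) (x' i)).
Proof.
move=> e0 w0 dx.
pose G i j := gradient (mollifier eps) (x i t - x j t).
pose F i := blob eps w (x^~ t) (x i t).
have dF i : is_derive t 1 (fun s => blob eps w (x^~ s) (x i s))
    (\sum_(j < N) w j * dotp (G i j) (x' i - x' j)).
  apply: is_derive_sum_fun => j.
  have dxij : is_derive t 1 (fun s => x i s - x j s) (x' i - x' j).
    exact: is_deriveB.
  apply: is_deriveZ; rewrite /G gradient_mollifier.
  exact: is_derive_mollifier_curve dxij.
have dH : is_derive t 1 (fun s => discrete_entropy eps w (x^~ s))
    (\sum_(i < N) w i *
       ((F i)^-1 * \sum_(j < N) w j * dotp (G i j) (x' i - x' j))).
  apply: is_derive_sum_fun => i.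
  have dln := is_derive1_ln (blob_gt0 eps w (x^~ t) i (x i t) e0 w0).
  exact: (is_deriveZ (w i) (is_derive1_comp dln (dF i))).
apply: is_derive_eq.
have swap :
    \sum_(i < N) \sum_(j < N) w i * w j * (F j)^-1 * dotp (G i j) (x' i)
    = - \sum_(i < N) \sum_(j < N) w i * w j * (F i)^-1 * dotp (G i j) (x' j).
  rewrite exchange_big -sumrN; apply: eq_bigr => i _.
  rewrite -sumrN; apply: eq_bigr => j _.
  by rewrite /G -opprB gradient_mollifierN dotpNl mulrN (mulrC (w j)).
transitivity
  (\sum_(i < N) \sum_(j < N) w i * w j * (F i)^-1 * dotp (G i j) (x' i)
   + \sum_(i < N) \sum_(j < N) w i * w j * (F j)^-1 * dotp (G i j) (x' i)).
  rewrite swap -sumrB; apply: eq_bigr => i _.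
  rewrite -sumrB !mulr_sumr; apply: eq_bigr => j _.
  by rewrite dotpBr; ring.
rewrite -big_split; apply: eq_bigr => i _ /=.
rewrite /entropy_gradient gradient_blob dotpDl dotpZl !dotp_suml.
rewrite mulr_sumr -!big_split mulr_sumr; apply: eq_bigr => j _ /=.
by rewrite !dotpZl -/(G i j) -/(F i) -/(F j); ring.
Qed.

Theorem theorem2 (R : realType) (d N : nat) (C gamma eps : R) (w : 'I_N -> R)
    (J : set R) (v : 'I_N -> R -> 'cV[R]_d)
    (hd : (2 <= d)%N) (hC : 0 < C)
    (hgamma : - d%:R - 1 <= gamma <= 1)
    (heps : 0 < eps) (hw : forall i : 'I_N, 0 < w i)
    (hJ : open J) (hv : particle_solution C gamma eps w J v) :
  (forall t : R, J t ->
     [/\ is_derive t (1 : R) (fun _ : R => \sum_(i < N) w i) 0,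
         is_derive t (1 : R) (fun s : R => \sum_(i < N) w i *: v i s) 0
       & is_derive t (1 : R)
           (fun s : R => \sum_(i < N) w i * enorm (v i s) ^+ 2) 0])
  /\
  (forall t : R, J t ->
     is_derive t (1 : R) (fun s : R => discrete_entropy eps w (fun i => v i s))
       (- entropy_dissipation C gamma eps w (fun i => v i t))
     /\ - entropy_dissipation C gamma eps w (fun i => v i t) <= 0).
Proof.
pose F t i j := landau_kernel C gamma (v i t - v j t)
  *m entropy_gradient_diff eps w (v^~ t) (v i t) (v j t).
have Fanti t i j : F t j i = - F t i j.
  rewrite /F -opprB landau_kernelN -mulmxN /entropy_gradient_diff.
  by rewrite (opprB (entropy_gradient _ _ _ (v i t))).
have wf t (phi : 'I_N -> 'cV[R]_d) := weak_form w (F t) phi (Fanti t).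
have dv t i : J t -> is_derive t 1 (v i) (- \sum_(j < N) w j *: F t i j).
  exact: hv.
split=> t Jt; last first.
  split.
    apply: is_derive_eq.
      apply: is_derive_discrete_entropy => // i; exact: dv.
    exact: wf.
  rewrite oppr_le0 mulr_ge0 ?invr_ge0 ?ler0n //.
  apply: sumr_ge0 => i _; apply: sumr_ge0 => j _.
  by rewrite !mulr_ge0 ?landau_kernel_psd // ltW.
split; first exact: is_derive_cst.
- have dM : is_derive t 1 (fun s : R => \sum_(i < N) w i *: v i s)
      (\sum_(i < N) w i *: - \sum_(j < N) w j *: F t i j).
    by apply: is_derive_sum_fun => i; apply: is_deriveZ; apply: dv.
  apply: is_derive_eq; apply/matrixP => k l; rewrite ord1 mxE.
  rewrite -dotp_deltar dotp_suml.
  under eq_bigr do rewrite dotpZl dotpC.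
  (* The test vectors are all equal to the [k]-th basis vector. *)
  rewrite wf big1 ?mulr0 ?oppr0 // => i _; rewrite big1 // => j _.
  by rewrite subrr dotpC dotp0r mulr0.
- have dE : is_derive t 1 (fun s : R => \sum_(i < N) w i * enorm (v i s) ^+ 2)
      (\sum_(i < N) w i *
        (2 * dotp (v i t) (- \sum_(j < N) w j *: F t i j))).
    apply: is_derive_sum_fun => i.
    under eq_fun do rewrite enorm_sqr.
    apply: is_deriveZ; have := is_derive_dotp _ _ _ _ _ (dv _ i Jt) (dv _ i Jt).
    by rewrite (dotpC (- _)) -mulr2n -(mulr_natl (dotp _ _)).
  apply: (is_derive_eq dE); under eq_bigr do rewrite mulrCA.
  rewrite -mulr_sumr wf big1 ?mulr0 ?oppr0 ?mulr0 // => i _.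
  rewrite big1 // => j _.
  by rewrite dotp_landau_kernel_self mulr0.
Qed.
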